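(* Let $\mathfrak g$ be of type $A_1^{(1)}$. If $M=\prod_{i\in\{0,1\}}\prod_{k\ge 0}Y_{i,k}^{y_{i,k}}\mathbf 1\in\mathcal M(\infty)$, then $$D(M)=\sum_{k\ge 0}\ \sum_{j=0}^{k}\bigl((2j+1)\,y_{0,k-j}+(2j+2)\,y_{1,k-j}\bigr).$$
   Context: Type $A_1^{(1)}$: $I=\{0,1\}$, Cartan matrix $C_{00}=C_{11}=2$, $C_{01}=C_{10}=-2$. Modified Nakajima monomials: $\widehat{\mathcal M}$ is the set of monomials $M=\prod_{i\in I}\prod_{k\ge0}Y_{i,k}^{y_{i,k}}\mathbf 1$ in formal commuting variables $Y_{i,k}$ ($i\in I$, $k\ge 0$) times an additional formal commuting variable $\mathbf 1$, where $y_{i,k}\in\mathbb Z$ and all but finitely many $y_{i,k}$ are $0$. For such $M$ and $i\in I$ put $\langle h_i,\mathrm{wt}(M)\rangle=\sum_{k\ge0}y_{i,k}$, $\varphi_i(M)=\max\{\sum_{j=0}^k y_{i,j}:k\ge0\}$, $\varepsilon_i(M)=\varphi_i(M)-\langle h_i,\mathrm{wt}(M)\rangle$, $k_f=\min\{k\ge0:\varphi_i(M)=\sum_{j=0}^k y_{i,j}\}$, $k_e=\max\{k\ge0:\varphi_i(M)=\sum_{j=0}^k y_{i,j}\}$ (used only when $\varepsilon_i(M)>0$). Put $$A_{0,k}=Y_{0,k}Y_{0,k+1}Y_{1,k+1}^{-2},\qquad A_{1,k}=Y_{1,k}Y_{1,k+1}Y_{0,k}^{-2}.$$ The Kashiwara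 operators are $\widetilde f_iM=A_{i,k_f}^{-1}M$, and $\widetilde e_iM=A_{i,k_e}M$ if $\varepsilon_i(M)>0$, $\widetilde e_iM=0$ if $\varepsilon_i(M)=0$. $\mathcal M(\infty)$ is the connected component of $\widehat{\mathcal M}$, under application of the operators $\widetilde e_i,\widetilde f_i$ ($i\in I$), containing the monomial $\mathbf 1$ (all exponents $0$). It is known that $\mathcal M(\infty)$ is isomorphic to the crystal $B(\infty)$ as a $U_q'(\mathfrak g)$-crystal, with $\mathbf 1$ corresponding to the highest weight element; in particular every element of $\mathcal M(\infty)$ is of the form $\widetilde f_{b_1}\cdots\widetilde f_{b_\ell}\mathbf 1$. The function $D$: the weight lattice is $P=\mathbb Z\Lambda_0\oplus\mathbb Z\Lambda_1\oplus\mathbb Z\delta$ with $\alpha_0=2\Lambda_0-2\Lambda_1+\delta$ and $\alpha_1=2\Lambda_1-2\Lambda_0$. $D:\mathcal M(\infty)\to\mathbb Z$ is the function such that $\mathrm{wt}(M)=\sum_{i\in I}\bigl(\sum_{k\ge0}y_{i,k}\bigr)\Lambda_i+D(M)\delta$ is the affine weight function making $\mathcal M(\infty)$ a $U_q(\mathfrak g)$-crystal, i.e. $\mathrm{wt}(\mathbf 1)=0$ and $\mathrm{wt}(\widetilde f_iM)=\mathrm{wt}(M)-\alpha_i$ for all $i\in I$. Equivalently, if $M=\widetilde f_{b_1}\cdots\widetilde f_{b_\ell}\mathbf 1$, then $D(M)=-|\{1\le j\le\ell:b_j=0\}|$ (independent of the chosen expression). *)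

(* Defs.v *)
From HB Require Import structures.
From mathcomp Require Import all_boot all_order all_algebra.
From mathcomp Require Import freeg.

Set Implicit Arguments.
Unset Strict Implicit.
Unset Printing Implicit Defensive.

Import Order.TTheory GRing.Theory Num.Theory.

Local Open Scope ring_scope.

(* I = {0, 1}, the index set of A_1^(1). *)
Notation idx := 'I_2.

(* A modified Nakajima monomial, written additively: the monomials in the
   Y_{i,k} form the free abelian group on the pairs (i, k).  The symbol **1**
   occurs exactly once in every monomial, so it carries no data; the monomial
   **1** is the zero of the group. *)
Notation monomial := {freeg (idx * nat) / int}.

Definition Y (i : idx) (k : nat) : monomial := << (i, k) >>.

Definition y (M : monomial) (i : idx) (k : nat) : int := coeff (i, k) M.

(* <h_i, wt M>: the sum of the y_{i,k} over all k *)
Definition hwt (i : idx) (M : monomial) : int :=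
  \sum_(x <- dom M | x.1 == i) coeff x M.

Definition psum (i : idx) (M : monomial) (k : nat) : int :=
  \sum_(j < k.+1) y M i j.

(* No variable Y_{i,k} with k > bound M occurs in M, so psum i M is constant on
   the k >= bound M. *)
Definition bound (M : monomial) : nat := \max_(x <- dom M) x.2.

Lemma bound_dom (M : monomial) x : x \in dom M -> (x.2 <= bound M)%N.
Proof.
move=> xM; pose F (z : idx * nat) := z.2.
exact: (@leq_bigmax_seq _ (dom M) xpredT F x).
Qed.

Lemma y_out (M : monomial) i k : (bound M < k)%N -> y M i k = 0.
Proof.
move=> lt_bk; apply: coeff_outdom; apply: contraL lt_bk => ikM.
by rewrite -leqNgt (bound_dom ikM).
Qed.

Lemma psum_tail i (M : monomial) k :
  (bound M <= k)%N -> psum i M k = psum i M (bound M).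
Proof.
move=> le_bk; rewrite -(subnKC le_bk); elim: (k - _)%N => [|d IHd].
  by rewrite addn0.
by rewrite addnS {1}/psum big_ord_recr /= y_out ?addr0 // ltnS leq_addr.
Qed.

Lemma hwt_psum i (M : monomial) k : (bound M <= k)%N -> hwt i M = psum i M k.
Proof.
move=> le_bk; rewrite /psum /hwt.
pose s := [seq (i, j) | j <- iota 0 k.+1].
have -> : \sum_(j < k.+1) y M i j = \sum_(x <- s) coeff x M.
  by rewrite big_map -/(index_iota 0 k.+1) big_mkord.
rewrite -big_filter [RHS](bigID (fun x => x \in dom M)) /=.
rewrite [X in _ = _ + X]big1 ?addr0; last by move=> x; apply: coeff_outdom.
rewrite -[RHS]big_filter; apply: perm_big; apply: uniq_perm.
- by rewrite filter_uniq // uniq_dom.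
- by rewrite filter_uniq // map_inj_uniq ?iota_uniq // => a b [].
move=> [i' j]; rewrite !mem_filter /= [LHS]andbC.
case: (boolP (_ \in dom M)) => //= dM.
apply/eqP/mapP => [->|[j' _ [-> _]] //]; exists j => //.
rewrite mem_iota /= add0n ltnS; apply: leq_trans le_bk.
exact: bound_dom dM.
Qed.

Definition phi (i : idx) (M : monomial) : int :=
  \big[Num.max/psum i M 0]_(k < (bound M).+1) psum i M k.

(* phi is the maximum over all k >= 0: psum_le_phi and phi_attained. *)
Lemma psum_le_phi i (M : monomial) k : psum i M k <= phi i M.
Proof.
have H (j : 'I_(bound M).+1) : psum i M j <= phi i M by apply: le_bigmax.
case: (leqP k (bound M)) => [le_kb|/ltnW/psum_tail ->].
  by apply: (H (Ordinal (le_kb : (k < (bound M).+1)%N))).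
exact: (H ord_max).
Qed.

Lemma phi_attained_bound i (M : monomial) :
  exists2 k, (k <= bound M)%N & psum i M k == phi i M.
Proof.
rewrite /phi; elim/big_ind: _ => [|u v [k kb /eqP <-] [l lb /eqP <-]|j _].
- by exists 0%N.
- by case: leP => _; [exists l | exists k].
by exists j; rewrite // -ltnS.
Qed.

Lemma phi_attained i (M : monomial) : exists k, psum i M k == phi i M.
Proof. by have [k _ ?] := phi_attained_bound i M; exists k. Qed.

Definition eps (i : idx) (M : monomial) : int := phi i M - hwt i M.

Definition kf (i : idx) (M : monomial) : nat := ex_minn (phi_attained i M).

(* This is k_e only if eps i M > 0 (see keP); if eps i M = 0 then psum i M is
   equal to phi i M at infinitely many k, and there is no largest one. *)
Definition ke (i : idx) (M : monomial) : nat :=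
  \max_(k < (bound M).+1 | psum i M k == phi i M) k.

Lemma keP i (M : monomial) : 0 < eps i M ->
  psum i M (ke i M) = phi i M
  /\ forall k, psum i M k = phi i M -> (k <= ke i M)%N.
Proof.
move=> eps_gt0.
have attb k : psum i M k = phi i M -> (k < bound M)%N.
  move=> Ek; rewrite ltnNge; apply: contraL eps_gt0 => /hwt_psum H.
  by rewrite /eps (H i) Ek subrr ltxx.
split=> [|k Ek].
  have [k kb Ek] := phi_attained_bound i M.
  pose k' : 'I_(bound M).+1 := Ordinal (kb : (k < (bound M).+1)%N).
  rewrite /ke (bigop.bigmax_eq_arg k') //.
  by case: arg_maxnP => // j /eqP.
have kb : (k < (bound M).+1)%N by rewrite ltnS ltnW ?attb.
by apply: (leq_bigmax_cond (Ordinal kb)); apply/eqP.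
Qed.

Definition A (i : idx) (k : nat) : monomial :=
  if i == 0 then Y 0 k + Y 0 k.+1 - Y 1 k.+1 *+ 2
            else Y 1 k + Y 1 k.+1 - Y 0 k *+ 2.

(* Kashiwara operators; [None] is the value 0 of the operator e. *)
Definition f (i : idx) (M : monomial) : monomial := M - A i (kf i M).

Definition e (i : idx) (M : monomial) : option monomial :=
  if 0 < eps i M then Some (M + A i (ke i M)) else None.

(* M(infinity): the connected component of **1** *)
Inductive Minf : monomial -> Prop :=
| Minf_one : Minf 0
| Minf_f i M : Minf M -> Minf (f i M)
| Minf_e i M M' : Minf M -> e i M = Some M' -> Minf M'.

(* The weight lattice Z Lambda_0 + Z Lambda_1 + Z delta *)
Notation weight := 'rV[int]_3.
Definition Lambda0 : weight := delta_mx 0 0.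
Definition Lambda1 : weight := delta_mx 0 1.
Definition delta : weight := delta_mx 0 2.

Definition Lambda (i : idx) : weight := if i == 0 then Lambda0 else Lambda1.

Definition alpha (i : idx) : weight :=
  if i == 0 then Lambda0 *+ 2 - Lambda1 *+ 2 + delta
            else Lambda1 *+ 2 - Lambda0 *+ 2.

Definition wt (D : monomial -> int) (M : monomial) : weight :=
  \sum_(i : idx) hwt i M *: Lambda i + D M *: delta.

(* D is the function on M(infinity) that completes the weight of a monomial to
   its affine weight; its values outside M(infinity) are irrelevant. *)
Definition affine_weight (D : monomial -> int) : Prop :=
  wt D 0 = 0 /\ forall i M, Minf M -> wt D (f i M) = wt D M - alpha i.

(* The sum of F k over all k >= 0 has finitely many nonzero terms and is s. *)
Definition sums_to (F : nat -> int) (s : int) : Prop :=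
  exists N, (forall k, (N <= k)%N -> F k = 0) /\ \sum_(k < N) F k = s.

(* Main.v *)
Require Import Defs.
From mathcomp Require Import all_boot all_order all_algebra.
From mathcomp Require Import freeg zify.

Import Order.TTheory GRing.Theory Num.Theory.

Local Open Scope ring_scope.

(** The double sum in the theorem is additive in [M], since every exponent
    [y M i k] is.  On [A 0 n] its value is 1 and on [A 1 n] it is 0
    ([sums_to_degree_A]): the coefficients 2j+1 and 2j+2 make the inner sum over
    [j] vanish for every [k], except for [k = n] in the case of [A 0 n].  On the
    other side, the delta-coordinate of [alpha i] is 1 if [i = 0] and 0 if
    [i = 1], so [D] falls by exactly the value of the double sum on the
    [A i n] that [f i] subtracts ([affine_weight_f]).

    Hence both sides vanish at the monomial 0 and change in the same way along
    each [f i].  The defining property of [D] speaks only of the operators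
    [f i]; a step along [e i] is covered because [f i] undoes [e i] ([e_K]), so
    that it is a step along [f i] read backwards. *)

Lemma yD M N i k : y (M + N) i k = y M i k + y N i k.
Proof. exact: coeffD. Qed.

Lemma yN M i k : y (- M) i k = - y M i k.
Proof. exact: coeffN. Qed.

Lemma y_Y i n i' k : y (Y i n) i' k = ((i == i') && (n == k))%:R.
Proof. by rewrite /y /Y coeffU mul1r xpair_eqE. Qed.

Lemma y_A i n k : y (A i n) i k = (n == k)%:R + (n.+1 == k)%:R.
Proof.
by case: i => [[|[]]] //= ?; rewrite /A /= mulr2n !yD yN yD !y_Y /= !subr0.
Qed.

Lemma psum_addA i M n k :
  psum i (M + A i n) k = psum i M k + (n <= k)%N%:R + (n < k)%N%:R.
Proof.
have sum_eq (m : nat) : \sum_(j < k.+1) (m == j :> nat)%:R = (m <= k)%N%:R :> int.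
  elim: k => [|k IHk]; first by rewrite big_ord1 leqn0.
  rewrite big_ord_recr /= IHk; lia.
rewrite /psum -addrA -!sum_eq -!big_split /=.
by apply: eq_bigr => j _; rewrite yD y_A.
Qed.

Lemma kf_unique i M k :
  (forall j, psum i M j <= psum i M k) ->
  (forall j, (j < k)%N -> psum i M j < psum i M k) -> kf i M = k.
Proof.
move=> le_k lt_k; rewrite /kf; case: ex_minnP => m /eqP Em min_m.
have Ek : psum i M k = phi i M.
  by apply/eqP; rewrite eq_le psum_le_phi -Em le_k.
apply/eqP; rewrite eqn_leq min_m ?Ek //= leqNgt; apply/negP => /lt_k.
by rewrite Em Ek ltxx.
Qed.

(** Adding [A i n], where [n] is the last maximum of the partial sums, raises
    the partial sum at [n] by 1, those before [n] by 0 and those after [n] by 2.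
    The latter were less than the maximum, so [n] becomes the first
    maximum. *)
Lemma e_K i M M' : e i M = Some M' -> f i M' = M.
Proof.
rewrite /e; case: ifP => // /keP [Ek last_k] [<-].
rewrite /f (@kf_unique _ _ (ke i M)) ?addrK // => j; rewrite !psum_addA Ek.
  have := psum_le_phi i M j; have := last_k j; lia.
have := psum_le_phi i M j; lia.
Qed.

Definition degree_term (M : monomial) (k : nat) : int :=
  \sum_(j < k.+1)
    ((2 * j + 1)%N%:Z * y M 0 (k - j)%N + (2 * j + 2)%N%:Z * y M 1 (k - j)%N).

Lemma degree_termD M N k :
  degree_term (M + N) k = degree_term M k + degree_term N k.
Proof.
rewrite /degree_term -big_split; apply: eq_bigr => j _ /=.
by rewrite !yD !mulrDr addrACA.
Qed.

Lemma degree_termN M k : degree_term (- M) k = - degree_term M k.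
Proof.
rewrite /degree_term -sumrN; apply: eq_bigr => j _.
by rewrite !yN !mulrN opprD.
Qed.

Lemma degree_term_Y i n k :
  degree_term (Y i n) k =
    if (n <= k)%N then (2 * (k - n) + (if i == 0%R then 1 else 2))%N%:Z else 0.
Proof.
pose c j := (2 * j + (if i == 0%R then 1 else 2))%N%:Z.
rewrite /degree_term (eq_bigr (fun j : 'I__ => c j * (n == k - j)%N%:R)).
  rewrite -/(c (k - n)%N) -(big_mkord xpredT (fun j => c j * (n == k - j)%N%:R)).
  case: (leqP n k) => [le_nk|lt_kn].
    rewrite (bigD1_seq (k - n)%N) ?iota_uniq ?mem_index_iota ?ltnS ?leq_subr //=.
    rewrite subKn // eqxx mulr1 big_nat_cond big1 ?addr0 // => j jP.
    by rewrite (_ : (n == _) = false) ?mulr0 //; lia.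
  rewrite big1 // => j _; rewrite (_ : (n == _) = false) ?mulr0 //; lia.
move=> j _; rewrite !y_Y /c.
by case: i {c} => [[|[]]] //= ?; rewrite ?mulr0 ?addr0 ?add0r.
Qed.

(** For [k > n] the contributions of the three kinds of factors cancel:
    with [d = k - n], those of [A 0 n] are (2d+1) + (2d-1) - 2(2d), and those of
    [A 1 n] are (2d+2) + 2d - 2(2d+1).  For [k = n], the factors of index [n.+1]
    are still absent: [A 0 n] gives 1, and [A 1 n] gives 2 - 2. *)
Lemma degree_term_A i n k : degree_term (A i n) k = ((i == 0) && (n == k))%:R.
Proof.
rewrite /A; case: (i == 0);
  rewrite mulr2n !degree_termD degree_termN degree_termD !degree_term_Y;
  by case: (ltngtP n k) => [lt_nk|lt_kn|->] /=; lia.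
Qed.

Lemma sums_toD F G H s t :
  (forall k, H k = F k + G k) -> sums_to F s -> sums_to G t ->
  sums_to H (s + t).
Proof.
have extend K u m n : (forall k, (m <= k)%N -> K k = 0) ->
    \sum_(k < m) K k = u -> \sum_(k < m + n) K k = u :> int.
  move=> K0 <-; rewrite big_split_ord /= [X in _ + X]big1 ?addr0 // => k _.
  by rewrite K0 ?leq_addr.
move=> HE [m [F0 sF]] [n [G0 sG]]; exists (m + n)%N; split=> [k le_k|].
  by rewrite HE F0 ?G0 ?addr0 //; lia.
under eq_bigr do rewrite HE.
rewrite big_split /= (extend _ s) //; congr (_ + _).
by rewrite addnC; apply: extend.
Qed.

Lemma sums_toN F G s :
  (forall k, G k = - F k) -> sums_to F s -> sums_to G (- s).
Proof.
move=> GE [m [F0 <-]]; exists m; split=> [k le_mk|].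
  by rewrite GE F0 ?oppr0.
by rewrite -sumrN; apply: eq_bigr => k _; rewrite GE.
Qed.

Lemma sums_to_degree_A i n : sums_to (degree_term (A i n)) (i == 0)%:R.
Proof.
exists n.+1; split=> [k lt_nk|].
  by rewrite degree_term_A (ltn_eqF lt_nk) andbF.
rewrite big_ord_recr /= degree_term_A eqxx andbT big1 ?add0r // => k _.
by rewrite degree_term_A (gtn_eqF (ltn_ord k)) andbF.
Qed.

Lemma wt_delta D M : wt D M 0 2 = D M.
Proof.
rewrite /wt big_ord_recl big_ord1 /Lambda /= !mxE /=.
by rewrite !mulr0 !add0r mulr1.
Qed.

Lemma alpha_delta i : alpha i 0 2 = (i == 0)%:R.
Proof. by rewrite /alpha; case: (i == 0); rewrite ?mulr2n !mxE. Qed.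

Lemma affine_weight_f D i M :
  affine_weight D -> Minf M -> D (f i M) = D M - (i == 0)%:R.
Proof.
move=> [_ wtf] hM.
by rewrite -!wt_delta wtf // mxE [X in _ + X]mxE alpha_delta wt_delta.
Qed.

Theorem theorem3p3 (D : monomial -> int) (hD : affine_weight D)
    (M : monomial) (hM : Minf M) :
  sums_to
    (fun k : nat => \sum_(j < k.+1)
       ((2 * j + 1)%N%:Z * y M 0 (k - j)%N + (2 * j + 2)%N%:Z * y M 1 (k - j)%N))
    (D M).
Proof.
rewrite -/(degree_term M).
elim: hM => [|i N hN IHN|i N N' hN IHN eN].
- have -> : D 0 = 0 by rewrite -wt_delta hD.1 mxE.
  exists 0%N; split=> [k _|]; last by rewrite big_ord0.
  by rewrite /degree_term big1 // => j _; rewrite /y !coeff0 !mulr0.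
- rewrite affine_weight_f //; apply: sums_toD (degree_termD _ _) IHN _.
  exact: sums_toN (degree_termN _) (sums_to_degree_A _ _).
have fN' := e_K _ _ _ eN.
have DN : D N = D N' - (i == 0)%:R.
  by rewrite -affine_weight_f ?fN' //; apply: Minf_e eN.
have -> : D N' = D N + (i == 0)%:R by rewrite DN subrK.
have -> : N' = N + A i (kf i N') by rewrite -{1}fN' subrK.
exact: sums_toD (degree_termD _ _) IHN (sums_to_degree_A _ _).
Qed.
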